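(* Fix $\kappa\ge 0$. For each $n\ge 1$ let $X_n=X_n(t)$, $t\in[0,\infty)$, be a stochastic process with trajectories in $\mathbb C_0$, and assume the following three conditions. (I) For every $T\in(0,\infty)$ there is a good rate function $I_0^T:\mathbb C[0,T]\to[0,\infty]$ such that for every measurable $B\subset\mathbb C[0,T]$ $$\limsup_{n\to\infty}\frac1n\ln\mathbf P(X_n^{(T)}\in B)\le -I_0^T([B]_T),\qquad \liminf_{n\to\infty}\frac1n\ln\mathbf P(X_n^{(T)}\in B)\ge -I_0^T((B)_T).$$ Moreover, for every $T\in(0,\infty)$ and every $f\in\mathbb C[0,T]$ with $f(0)=0$ there is $g=g_f\in\mathbb C_0$ such that $g^{(T)}=f$ and $I_0^U(g^{(U)})=I_0^T(f)$ for every $U\ge T$. (II) For every $r\ge 0$, $$\lim_{T\to\infty}\ \sup_{f\in B_r^+}\ \sup_{t\ge T}\frac{|f(t)|}{1+t^{1+\kappa}}=0,\qquad B_r^+:=\Big\{f\in\mathbb C:\ \limsup_{T\to\infty}I_0^T(f^{(T)})\le r\Big\}.$$ (III) For every $N<\infty$ and $\varepsilon>0$ there is $T=T_{N,\varepsilon}<\infty$ such that $$\limsup_{n\to\infty}\frac1n\ln\mathbf P\Big(\sup_{t\ge T}\frac{|X_n(t)|}{1+t^{1+\kappa}}>\varepsilon\Big)\le -N.$$ Then for every $f\in\mathbb C$ the limit $$I(f):=\lim_{T\to\infty}I_0^T(f^{(T)})$$ exists in $[0,\infty]$, $I$ is a good rate function on $(\mathbb C,\rho)$, and the sequence $X_n$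 satisfies the large deviation principle in $(\mathbb C,\rho)$ with rate function $I$; that is, for every measurable $B\subset\mathbb C$ $$\limsup_{n\to\infty}\frac1n\ln\mathbf P(X_n\in B)\le -I([B]),\qquad \liminf_{n\to\infty}\frac1n\ln\mathbf P(X_n\in B)\ge -I((B)).$$
   Context: $\mathbb C$ is the space of continuous functions $f:[0,\infty)\to\mathbb R$ with $$\rho(f,g)=\rho_\kappa(f,g):=\sup_{t\ge0}\frac{|f(t)-g(t)|}{1+t^{1+\kappa}}$$ ($\rho$ may equal $+\infty$ for some pairs; the topology is the one generated by the open $\rho$-balls of finite radius). $[B]$ and $(B)$ are the closure and the interior of $B\subset\mathbb C$ in $\rho$; measurable means Borel. $\mathbb C_0\subset\mathbb C$ is the set of $f\in\mathbb C$ with $f(0)=0$ and $\lim_{t\to\infty}\frac{f(t)}{1+t^{1+\kappa}}=0$. For $T\in(0,\infty)$, $\mathbb C[0,T]$ is the space of continuous real functions on $[0,T]$ with metric $\rho_T(f,g):=\sup_{0\le t\le T}\frac{|f(t)-g(t)|}{1+t^{1+\kappa}}$; $[B]_T$ and $(B)_T$ are the closure and interior of $B\subset\mathbb C[0,T]$. For $f\in\mathbb C$, $f^{(T)}\in\mathbb C[0,T]$ is the restriction of $f$ to $[0,T]$, and similarly for processes. A good rate function on a space is a function with values in $[0,\infty]$ that is lower semicontinuous and all of whose level sets $\{f: J(f)\le r\}$, $r\ge0$, are compact. For a set $B$ and a rate function $J$, $J(B):=\inf_{f\in B}J(f)$, $J(\emptyset):=\infty$. *)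

(* Defs.v *)
From HB Require Import structures.
From mathcomp Require Import all_boot all_order all_algebra.
From mathcomp Require Import all_classical all_reals all_analysis.

Set Implicit Arguments.
Unset Strict Implicit.
Unset Printing Implicit Defensive.

Import Order.TTheory GRing.Theory Num.Theory.
Import numFieldNormedType.Exports.

Local Open Scope classical_set_scope.
Local Open Scope ring_scope.

Definition weight (R : realType) (kappa t : R) : R := 1 + t `^ (1 + kappa).

(* A continuous function on D is represented by its unique extension to R
   that vanishes outside D, so that Leibniz equality is equality on D.
   kappa does not constrain the functions: it selects the metric. *)
Record cspace (R : realType) (kappa : R) (D : set R) := CSpace {
  cfun :> R -> R;
  cfun_continuous : {within D, continuous cfun};
  cfun_out : forall t, ~ D t -> cfun t = 0 }.

Notation Cinf kappa := (cspace kappa `[0, +oo[%classic).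
Notation C0T kappa T := (cspace kappa `[0, T]%classic).

Definition rho (R : realType) (kappa : R) (D : set R) (f g : cspace kappa D)
    : \bar R :=
  ereal_sup [set (`|f t - g t| / weight kappa t)%:E | t in D].

Section cspace_topology.
Context (R : realType) (kappa : R) (D : set R).
Notation C := (cspace kappa D).

HB.instance Definition _ := gen_eqMixin C.
HB.instance Definition _ := gen_choiceMixin C.

Definition rho_ball (f : C) (e : R) (g : C) : Prop := (rho f g < e%:E)%E.

Lemma weight_gt0 (t : R) : 0 < weight kappa t.
Proof. by rewrite /weight ltr_pwDl// powR_ge0. Qed.

Lemma rho_ball_center (f : C) (e : R) : 0 < e -> rho_ball f e f.
Proof.
move=> e0; rewrite /rho_ball (@le_lt_trans _ _ 0%E) ?lte_fin//.
by apply: ge_ereal_sup => _ [t _ <-]; rewrite subrr normr0 mul0r.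
Qed.

Lemma rho_ball_sym (f g : C) (e : R) : rho_ball f e g -> rho_ball g e f.
Proof.
rewrite /rho_ball /rho => h; apply: le_lt_trans h.
apply: ge_ereal_sup => _ [t Dt <-]; rewrite distrC.
by apply: ereal_sup_ubound; exists t.
Qed.

Lemma rho_ball_triangle (f g h : C) (e1 e2 : R) :
  rho_ball f e1 g -> rho_ball g e2 h -> rho_ball f (e1 + e2) h.
Proof.
rewrite /rho_ball => fg gh; rewrite EFinD.
apply: le_lt_trans (lteD fg gh); apply: ge_ereal_sup => _ [t Dt <-].
have -> : f t - h t = (f t - g t) + (g t - h t) by rewrite addrA subrK.
apply: (@le_trans _ _ ((`|f t - g t| / weight kappa t)%:E +
                       (`|g t - h t| / weight kappa t)%:E)%E).
  by rewrite -EFinD lee_fin -mulrDl ler_pM2r ?invr_gt0 ?weight_gt0// ler_normD.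
by apply: leeD; apply: ereal_sup_ubound; exists t.
Qed.

(* rho may take the value +oo, so it is not a metricType distance; it is still
   a pseudoMetricType, whose balls are the rho-balls of finite radius. *)
HB.instance Definition _ :=
  hasNbhs.Build C (nbhs_ (entourage_ rho_ball)).
HB.instance Definition _ := Nbhs_isPseudoMetric.Build R C
  erefl rho_ball_center rho_ball_sym rho_ball_triangle erefl.

End cspace_topology.

Lemma restr_continuous (R : realType) (kappa T : R) (f : Cinf kappa) :
  {within `[0, T], continuous (f \_ `[0, T])}.
Proof.
have sub : `[0, T]%classic `<=` (`[0, +oo[%classic : set R).
  by move=> t /=; rewrite !in_itv/= => /andP[->].
apply: (@subspace_eq_continuous _ _ _ f); last first.
  exact: continuous_subspaceW sub (@cfun_continuous _ _ _ f).
by move=> t tT; rewrite /from_subspace patchT.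
Qed.

Lemma restr_out (R : realType) (kappa T : R) (f : Cinf kappa) (t : R) :
  ~ `[0, T]%classic t -> (f \_ `[0, T]) t = 0.
Proof. by move=> tT; rewrite patchN// !inE; apply/negP; rewrite inE. Qed.

Definition restr (R : realType) (kappa T : R) (f : Cinf kappa) : C0T kappa T :=
  @CSpace R kappa _ _ (@restr_continuous R kappa T f) (@restr_out R kappa T f).
Arguments restr {R kappa} T f.

Definition C0 (R : realType) (kappa : R) : set (Cinf kappa) :=
  [set f | f 0 = 0 /\ f t / weight kappa t @[t --> +oo] --> (0 : R)].

Definition tail_sup (R : realType) (kappa T : R) (f : Cinf kappa) : \bar R :=
  ereal_sup [set (`|f t| / weight kappa t)%:E | t in [set t | 0 <= t /\ T <= t]].

Definition Borel (S : topologicalType) : set (set S) := <<s @open S >>.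

Local Open Scope ereal_scope.

Definition good_rate_function (R : realType) (S : topologicalType)
    (J : S -> \bar R) : Prop :=
  [/\ forall x, 0 <= J x,
      lower_semicontinuous J &
      forall r : R, (0 <= r)%R -> compact [set x | J x <= r%:E]].

Definition rate_of_set (R : realType) (S : Type) (J : S -> \bar R)
    (B : set S) : \bar R := ereal_inf (J @` B).

(* Only n >= 1 matters: the junk term n = 0 does not affect limits in n. *)
Definition log_prob (R : realType) (d : nat -> measure_display)
    (Omega : forall n, measurableType (d n))
    (P : forall n, probability (Omega n) R)
    (A : forall n, set (Omega n)) : (\bar R)^nat :=
  fun n => (n%:R^-1)%:E * lne (P n (A n)).

Definition LDP (R : realType) (d : nat -> measure_display)
    (Omega : forall n, measurableType (d n))
    (P : forall n, probability (Omega n) R)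
    (S : topologicalType) (X : forall n, Omega n -> S) (J : S -> \bar R)
    : Prop :=
  forall B : set S, Borel B ->
    limn_esup (log_prob P (fun n => X n @^-1` B)) <= - rate_of_set J (closure B)
    /\ - rate_of_set J (interior B) <=
       limn_einf (log_prob P (fun n => X n @^-1` B)).

Definition B_plus (R : realType) (kappa : R)
    (I0 : forall T, C0T kappa T -> \bar R) (r : R) : set (Cinf kappa) :=
  [set f | limf_esup (fun T => I0 T (restr T f)) (pinfty_nbhs R) <= r%:E].

(* The limit I(f); meaningful once convergence is known. *)
Definition limit_rate (R : realType) (kappa : R)
    (I0 : forall T, C0T kappa T -> \bar R) (f : Cinf kappa) : \bar R :=
  lim (I0 T (restr T f) @[T --> +oo%R]).

(* Main.v *)
(* Consistency of the path LDPs makes [T |-> I_0^T (f^(T))] nondecreasing, so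
   the limit [I] exists and equals the supremum over [T > 0].

   Goodness of [I]: on [{I <= r}] the tails are uniformly small by (II), and each
   restriction lies in a compact level set; limits of an ultrafilter on [0, n+1]
   therefore glue to a limit in [rho].

   Upper bound: for [c < I [B]] the compact set [{I <= c}] is at [rho]-distance
   at least [e] from [B]. By the extension part of (I), the restrictions of its
   elements to [0, T] fill the whole level set [{I_0^T <= c}]. Hence [X_n] in [B]
   forces either a large tail, which (III) makes negligible, or [X_n^(T)] to stay
   at distance [e/2] from [{I_0^T <= c}], which the LDP on [0, T] controls.

   Lower bound: a [rho]-ball around [f] contains the paths that are close to [f]
   on [0, T] and have a small tail; the tail event costs a rate above [I f].

   Every probability estimate needs [X_n] to be Borel for [rho]. The space
   [(C, rho)] is not separable, but [C_0] is covered by countably many sets of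
   small diameter described by the coordinates alone. *)
Require Import Defs.
From mathcomp Require Import all_boot all_order all_algebra.
From mathcomp Require Import lra.
From mathcomp Require Import all_classical all_reals all_analysis.
Import Order.TTheory GRing.Theory Num.Theory.
Import numFieldNormedType.Exports.

Set Implicit Arguments.
Unset Strict Implicit.
Unset Printing Implicit Defensive.

Local Open Scope classical_set_scope.
Local Open Scope ring_scope.
Local Open Scope ereal_scope.

(** * Comparisons in the extended reals and eventual forms of upper and lower limits *)

Lemma exists_EFin_between (R : realType) (a b : \bar R) :
  a < b -> exists z : R, a < z%:E < b.
Proof.
move: a b => [a| |] [b| |]//=.
- by rewrite lte_fin => ab; exists ((a + b) / 2)%R; rewrite !lte_fin !midf_lt.
- by move=> _; exists (a + 1)%R; rewrite lte_fin ltrDl ltr01 ltry.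
- by move=> _; exists (b - 1)%R; rewrite lte_fin ltrBlDr ltrDl ltr01 ltNyr.
- by move=> _; exists 0%R; rewrite ltNyr ltry.
Qed.

Lemma lee_EFin_gt (R : realType) (a b : \bar R) :
  (forall y : R, b < y%:E -> a <= y%:E) -> a <= b.
Proof.
move=> h; rewrite leNgt; apply/negP => /exists_EFin_between[z /andP[bz]].
by rewrite ltNge h.
Qed.

Lemma lee_EFin_lt (R : realType) (a b : \bar R) :
  (forall y : R, y%:E < a -> y%:E <= b) -> a <= b.
Proof.
move=> h; rewrite leNgt; apply/negP => /exists_EFin_between[z /andP[bz za]].
by move: bz; rewrite ltNge h.
Qed.

(** The upper limit is an infimum of suprema over eventual sets, and [[set n | u n <= y%:E]] is
    itself such a set. Testing only real [y] above [x] treats finite and infinite [x] alike. *)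
Lemma limn_esup_leP (R : realType) (u : (\bar R)^nat) (x : \bar R) :
  limn_esup u <= x <->
  forall y : R, x < y%:E -> \forall n \near \oo, u n <= y%:E.
Proof.
split=> [ux y xy|uy].
  have /ereal_inf_lt[_ [V FV <-] Vy] := le_lt_trans ux xy.
  apply: filterS FV => n Vn; apply: le_trans (ltW Vy).
  by apply: ereal_sup_ubound; exists n.
apply: lee_EFin_gt => y /uy uyn.
apply: le_trans (_ : ereal_sup (u @` [set n | u n <= y%:E]) <= _).
  by apply: ereal_inf_lbound; eexists; first exact: uyn.
by apply: ge_ereal_sup => _ [n un <-].
Qed.

Lemma limn_einf_geP (R : realType) (u : (\bar R)^nat) (x : \bar R) :
  x <= limn_einf u <->
  forall y : R, y%:E < x -> \forall n \near \oo, y%:E <= u n.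
Proof.
rewrite /limn_einf leeNr limn_esup_leP; split=> h y.
  by rewrite -lteN2 -EFinN => /h; apply: filterS => n; rewrite EFinN leeN2.
rewrite lteNl => /h; apply: filterS => n; by rewrite -[y%:E]oppeK leeN2.
Qed.

(** * Exponential rates of probabilities *)

Section log_prob.
Context (R : realType) (d : nat -> measure_display)
  (Omega : forall n, measurableType (d n))
  (P : forall n, probability (Omega n) R).
Implicit Types A B C : forall n, set (Omega n).

Lemma log_prob_le A (n : nat) (y : R) : (0 < n)%N ->
  (log_prob P A n <= y%:E) = (P n (A n) <= (expR (n%:R * y))%:E).
Proof.
move=> n0; rewrite /log_prob lee_pdivrMl ?ltr0n// -EFinM -[LHS]lee_expeR lneK//.
by rewrite in_itv/= measure_ge0 leey.
Qed.

Lemma log_prob_ge A (n : nat) (y : R) : (0 < n)%N ->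
  (y%:E <= log_prob P A n) = ((expR (n%:R * y))%:E <= P n (A n)).
Proof.
move=> n0; rewrite /log_prob lee_pdivlMl ?ltr0n// -EFinM -[LHS]lee_expeR lneK//.
by rewrite in_itv/= measure_ge0 leey.
Qed.

(** Removes the logarithm, so that probabilities can be added and compared directly; an event of
    probability zero needs no separate case. *)
Lemma log_prob_esupP A (x : \bar R) :
  limn_esup (log_prob P A) <= x <->
  forall y : R, x < y%:E -> \forall n \near \oo, P n (A n) <= (expR (n%:R * y))%:E.
Proof.
rewrite limn_esup_leP; split=> h y /h H; near=> n.
  rewrite -log_prob_le; first by near: n.
  by near: n; exact: nbhs_infty_gt.
rewrite log_prob_le; first by near: n.
by near: n; exact: nbhs_infty_gt.
Unshelve. all: by end_near.
Qed.

Lemma log_prob_einfP A (x : \bar R) :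
  x <= limn_einf (log_prob P A) <->
  forall y : R, y%:E < x -> \forall n \near \oo, (expR (n%:R * y))%:E <= P n (A n).
Proof.
rewrite limn_einf_geP; split=> h y /h H; near=> n.
  rewrite -log_prob_ge; first by near: n.
  by near: n; exact: nbhs_infty_gt.
rewrite log_prob_ge; first by near: n.
by near: n; exact: nbhs_infty_gt.
Unshelve. all: by end_near.
Qed.

(** Write [expR (n * z)] as [expR (n * (z - y)) * expR (n * y)]; the first factor is at least
    [1 + n * (z - y)], hence at least 2 once [n >= 1 / (z - y)]. *)
Lemma expR_dominates (y z : R) : (y < z)%R ->
  \forall n \near \oo, (expR (n%:R * y) + expR (n%:R * y) <= expR (n%:R * z))%R.
Proof.
move=> yz; near=> n.
have -> : (n%:R * z = n%:R * (z - y) + n%:R * y)%R by rewrite -mulrDr subrK.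
rewrite expRD -mulr2n -[leLHS]mulr_natl ler_pM2r ?expR_gt0//.
apply: le_trans (expR_ge1Dx _); rewrite (_ : 2%:R = 1 + 1)%R// lerD2l.
rewrite -ler_pdivrMr ?subr_gt0//.
by near: n; exact: nbhs_infty_ger.
Unshelve. all: by end_near.
Qed.

Lemma log_prob_esup_mono A B (x : \bar R) :
  (\forall n \near \oo, P n (A n) <= P n (B n)) ->
  limn_esup (log_prob P B) <= x -> limn_esup (log_prob P A) <= x.
Proof.
move=> AB /log_prob_esupP Bx; apply/log_prob_esupP => y /Bx H.
by apply: filterS2 AB H => n; exact: le_trans.
Qed.

Lemma log_prob_esup_le0 A :
  (\forall n \near \oo, measurable (A n)) -> limn_esup (log_prob P A) <= 0.
Proof.
move=> mA; apply/log_prob_esupP => y y0; apply: filterS mA => n mA.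
apply: le_trans (probability_le1 _ mA) _.
rewrite lee_fin -expR0 ler_expR mulr_ge0// ltW//.
Qed.

(** On the exponential scale a sum of two probabilities decays like the larger one: the factor 2
    disappears in an arbitrarily small increase of the rate. *)
Lemma log_prob_esupU A B C (x : \bar R) :
  (\forall n \near \oo, P n (C n) <= P n (A n) + P n (B n)) ->
  limn_esup (log_prob P A) <= x -> limn_esup (log_prob P B) <= x ->
  limn_esup (log_prob P C) <= x.
Proof.
move=> CAB /log_prob_esupP Ax /log_prob_esupP Bx; apply/log_prob_esupP => y.
move=> /exists_EFin_between[z /andP[xz zy]].
near=> n; apply: (@le_trans _ _ (P n (A n) + P n (B n))); first by near: n.
apply: (@le_trans _ _ ((expR (n%:R * z))%:E + (expR (n%:R * z))%:E)).
  by apply: leeD; near: n; [exact: Ax|exact: Bx].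
by rewrite -EFinD lee_fin; near: n; exact: expR_dominates.
Unshelve. all: by end_near.
Qed.

(** Lower bound by difference: [P(C) >= P(A) - P(B)], where [B] is exponentially negligible against
    [A] because [y < x]. *)
Lemma log_prob_einfD A B C (x y : \bar R) : y < x ->
  (\forall n \near \oo, P n (A n) <= P n (C n) + P n (B n)) ->
  x <= limn_einf (log_prob P A) -> limn_esup (log_prob P B) <= y ->
  x <= limn_einf (log_prob P C).
Proof.
move=> yx ACB /log_prob_einfP Ax /log_prob_esupP By; apply/log_prob_einfP => u ux.
(* [w] is an eventual rate above that of [B], and [z] an eventual rate below that of [A]. Since [z]
   exceeds both [u] and [w], [expR (n * z)] dominates [expR (n * u) + expR (n * w)]. *)
have /exists_EFin_between[w /andP[yw wx]] := yx.
have /exists_EFin_between[z /andP[mz zx]] : (Num.max u w)%:E < x.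
  by rewrite EFin_max gt_max ux.
near=> n; rewrite -(@leeD2rE _ (expR (n%:R * w))%:E)//.
apply: (@le_trans _ _ (P n (C n) + P n (B n))); last first.
  by rewrite leeD2l//; near: n; exact: By.
apply: (@le_trans _ _ (P n (A n))); last by near: n.
apply: (@le_trans _ _ (expR (n%:R * z))%:E); last by near: n; exact: Ax.
rewrite -EFinD lee_fin.
apply: (@le_trans _ _ (expR (n%:R * Num.max u w) + expR (n%:R * Num.max u w))%R).
  by apply: lerD; rewrite ler_expR ler_wpM2l// le_max lexx ?orbT.
by near: n; exact: expR_dominates.
Unshelve. all: by end_near.
Qed.

Lemma log_prob_einf_le_esup A B (x y : \bar R) :
  (\forall n \near \oo, P n (A n) <= P n (B n)) ->
  x <= limn_einf (log_prob P A) -> limn_esup (log_prob P B) <= y -> x <= y.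
Proof.
move=> AB xA By; apply: le_trans xA _; apply: le_trans (limn_einf_sup _) _.
exact: log_prob_esup_mono AB By.
Qed.

End log_prob.

(** * Measurability for the metric [rho] *)

Section cspace_facts.
Context (R : realType) (kappa : R).
Local Open Scope ring_scope.

Lemma itv0yE (t : R) : `[0, +oo[%classic t = (0 <= t) :> Prop.
Proof. by rewrite /= in_itv/= andbT. Qed.

Lemma cspace_near (D : set R) (f : cspace kappa D) (t e : R) : D t -> 0 < e ->
  exists2 r, 0 < r & forall s, D s -> `|s - t| < r -> `|f s - f t| < e.
Proof.
move=> Dt e0; have := @cfun_continuous _ _ _ f t.
move=> /cvgrPdist_lt/(_ e e0).
rewrite /nbhs/= -(nbhs_subspace_in Dt) => -[r r0 H].
exists r => // s Ds st; rewrite distrC; apply: H => //=.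
by rewrite distrC.
Qed.

(** Heine's theorem, through the near-covering form of compactness of [[0, H]]. Only [t] is confined
    to the segment. *)
Lemma unif_continuous_segment (f : Cinf kappa) (H e : R) : 0 < e ->
  exists2 r, 0 < r & forall s t, 0 <= s -> 0 <= t -> t <= H -> `|s - t| < r ->
    `|f s - f t| < e.
Proof.
move=> e0; have /compact_near_coveringP K := @segment_compact _ 0 H.
pose Q (r t : R) := 0 <= t -> forall s, 0 <= s -> `|s - t| < r -> `|f s - f t| < e.
have : \forall r \near (0:R)^'+, `[0, H] `<=` Q r.
  apply: K => t /=; rewrite in_itv/= => /andP[t0 tH].
  have [r r0 fr] : exists2 r, 0 < r & forall s, `[0, +oo[%classic s ->
      `|s - t| < r -> `|f s - f t| < e / 2.
    by apply: cspace_near; rewrite /= ?in_itv/= ?t0 ?divr_gt0.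
  exists (ball t (r / 2), [set x | x < r / 2]) => /=.
    by split; [apply: nbhsx_ballx|apply: nbhs_right_lt]; rewrite divr_gt0.
  move=> -[t' x]/= [tt' xr] t'0 s s0 st'.
  rewrite -(subrK (f t) (f s)) -addrA (splitr e).
  rewrite /ball/= distrC in tt'.
  apply: le_lt_trans (ler_normD _ _) _; apply: ltrD.
    apply: fr; first by rewrite /= in_itv/= s0.
    rewrite -(subrK t' s) -addrA (splitr r).
    apply: le_lt_trans (ler_normD _ _) _; apply: ltrD => //.
    exact: lt_trans st' xr.
  rewrite distrC; apply: fr; first by rewrite /= in_itv/= t'0.
  by rewrite (lt_le_trans tt')// ler_pdivrMr// mulr_natr mulr2n lerDl ltW.
move=> /nbhs_right0P [r r0 Hr].
exists (r / 2); first by rewrite divr_gt0.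
move=> s t s0 t0 tH st.
apply: (Hr (r / 2)) => //=.
- by rewrite sub0r normrN gtr0_norm ?divr_gt0// ltr_pdivrMr// mulr_natr mulr2n ltrDl.
- by rewrite divr_gt0.
- by rewrite /= in_itv/= t0 tH.
- by rewrite add0r.
Qed.

Lemma weight_ge1 (t : R) : 1 <= weight kappa t.
Proof. by rewrite /weight lerDl powR_ge0. Qed.

Lemma le_weight (s t : R) : 0 <= kappa -> 0 <= s -> s <= t ->
  weight kappa s <= weight kappa t.
Proof.
move=> k0 s0 st; rewrite /weight lerD2l; apply: ge0_ler_powR => //.
- by rewrite addr_ge0.
- by rewrite nnegrE (le_trans s0).
Qed.

Lemma rho_leP (D : set R) (f g : cspace kappa D) (c : R) :
  (rho f g <= c%:E)%E <->
  forall t, D t -> `|f t - g t| <= c * weight kappa t.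
Proof.
split=> [H t Dt|H].
  rewrite -ler_pdivrMr ?weight_gt0// -lee_fin; apply: le_trans H.
  by apply: ereal_sup_ubound; exists t.
apply: ge_ereal_sup => _ [t Dt <-].
by rewrite lee_fin ler_pdivrMr ?weight_gt0// H.
Qed.

(** Reduces [rho] to countably many coordinates by density of the rationals. A strict excess at
    [t > 0] would persist at a rational [q] slightly to the left of [t]; choosing [q < t] lets
    monotonicity of [weight] replace its continuity. The point 0 is itself rational. *)
Lemma rho_le_rat (f g : Cinf kappa) (c : R) : 0 <= kappa -> 0 <= c ->
  (forall q : rat, 0 <= ratr q :> R ->
     `|f (ratr q) - g (ratr q)| <= c * weight kappa (ratr q)) ->
  (rho f g <= c%:E)%E.
Proof.
move=> k0 c0 H; apply/rho_leP => t tD; have := tD; rewrite /= in_itv/= andbT.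
rewrite le_eqVlt => /predU1P[<-|t0].
  by have := H 0; rewrite rmorph0; apply.
rewrite leNgt; apply/negP => ct.
set e := `|f t - g t| - c * weight kappa t.
have e0 : 0 < e by rewrite subr_gt0.
have Dt : `[0, +oo[%classic t by rewrite /= in_itv/= ltW.
have [r r0 fr] := @cspace_near _ f t (e / 2) Dt (divr_gt0 e0 (ltr0n _ 2)).
have [r' r'0 gr] := @cspace_near _ g t (e / 2) Dt (divr_gt0 e0 (ltr0n _ 2)).
have /rat_in_itvoo[q] : Num.max 0 (Num.max (t - r) (t - r')) < t.
  by rewrite !gt_max t0 !ltrBlDr !ltrDl r0.
rewrite in_itv/= !gt_max => /andP[/andP[q0 /andP[rq r'q]] qt].
have Dq : `[0, +oo[%classic (ratr q : R) by rewrite itv0yE ltW.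
have Hq : `|f (ratr q) - g (ratr q)| <= c * weight kappa t.
  by rewrite (le_trans (H q (ltW q0)))// ler_wpM2l// le_weight// ltW.
have fq : `|f (ratr q) - f t| < e / 2.
  by apply: fr => //; rewrite distrC ger0_norm ?subr_ge0 ?ltW// ltrBlDr -ltrBlDl.
have gq : `|g (ratr q) - g t| < e / 2.
  by apply: gr => //; rewrite distrC ger0_norm ?subr_ge0 ?ltW// ltrBlDr -ltrBlDl.
have : `|f t - g t| < e / 2 + c * weight kappa t + e / 2.
  rewrite (_ : f t - g t = (f t - f (ratr q)) + (f (ratr q) - g (ratr q)) +
    (g (ratr q) - g t)); last by rewrite [X in _ = X + _]addrA subrK addrA subrK.
  apply: le_lt_trans (ler_normD _ _) _; apply: ler_ltD => //.
  apply: le_trans (ler_normD _ _) _; apply: lerD => //.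
  by rewrite distrC ltW.
by rewrite addrAC -splitr /e subrK ltxx.
Qed.

(* With [p = (k, m, s)]: the paths within [weight / (k + 1)], at rational times,
   of the step function of mesh [1 / (m + 1)] with values [s], which is zero after
   the end of [s] (the default of [nth]). *)
Definition cell (p : nat * nat * seq rat) : set (Cinf kappa) :=
  [set f | forall q : rat, 0 <= ratr q :> R ->
    `|f (ratr q) - ratr (nth 0 p.2 (Num.truncn (ratr q * p.1.2.+1%:R : R)))| <=
    p.1.1.+1%:R^-1 * weight kappa (ratr q)].

Lemma cell_diameter (p : nat * nat * seq rat) (f g : Cinf kappa) : 0 <= kappa ->
  cell p f -> cell p g -> (rho f g <= (p.1.1.+1%:R^-1 *+ 2)%:E)%E.
Proof.
move=> k0 pf pg; apply: rho_le_rat => //.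
move=> q q0; rewrite mulr2n mulrDl.
set a : R := ratr (nth 0 p.2 (Num.truncn (ratr q * p.1.2.+1%:R : R))).
rewrite -(subrK a (f _)) -addrA; apply: le_trans (ler_normD _ _) _.
by apply: lerD; [exact: pf|rewrite distrC; exact: pg].
Qed.

(** Beyond some [H] the path is within [e * weight] of zero; on [[0, H]] uniform continuity makes it
    close to its values at mesh points, and these are approximated by rationals. *)
Lemma C0_cell (f : Cinf kappa) (k : nat) : C0 f -> exists m s, cell (k, m, s) f.
Proof.
move=> [_ fl]; set e : R := k.+1%:R^-1.
have e0 : 0 < e by rewrite invr_gt0.
have [H H0 fH] : exists2 H : nat, (0 < H)%N &
    forall t, H%:R <= t -> `|f t| <= e * weight kappa t.
  move/cvgrPdist_le : fl => /(_ _ e0)[M [Mr fM]].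
  exists (Num.truncn (Num.max 0 M)).+1 => // t Ht.
  have : M < t.
    apply: lt_le_trans Ht.
    have := @truncn_itv _ (Num.max 0 M); rewrite le_max lexx => /(_ isT)/andP[_].
    by apply: le_lt_trans; rewrite le_max lexx orbT.
  move=> /fM/=; rewrite sub0r normrN normrM (@gtr0_norm _ (_^-1)) ?invr_gt0 ?weight_gt0//.
  by rewrite ler_pdivrMr ?weight_gt0.
have [r r0 fr] := @unif_continuous_segment f H%:R (e / 2) (divr_gt0 e0 (ltr0n _ 2)).
set m := Num.truncn r^-1.
have mr : m.+1%:R^-1 < r.
  rewrite invf_plt ?posrE//.
  by have := @truncn_itv _ r^-1; rewrite invr_ge0 ltW// => /(_ isT)/andP[].
have /choice[a af] : forall i : nat, exists q : rat,
    `|f (i%:R / m.+1%:R) - ratr q| < e / 2.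
  move=> i; have /rat_in_itvoo[q] : f (i%:R / m.+1%:R) - e / 2 < f (i%:R / m.+1%:R).
    by rewrite ltrBlDr ltrDl divr_gt0.
  rewrite in_itv/= => /andP[q1 q2]; exists q.
  by rewrite ger0_norm ?subr_ge0 ?ltW// ltrBlDr -ltrBlDl.
exists m, (mkseq a (H * m.+1)) => q q0 /=.
set x : R := ratr q in q0 *.
have xm0 : 0 <= x * m.+1%:R by rewrite mulr_ge0.
have /andP[ix xi] := truncn_itv xm0.
set i := Num.truncn _ in ix xi *.
have ix' : i%:R / m.+1%:R <= x by rewrite ler_pdivrMr.
have xi' : x < i%:R / m.+1%:R + m.+1%:R^-1.
  by rewrite -[X in _ + X]mul1r -mulrDl ltr_pdivlMr// natr1.
(* An index past the end of the list means [x >= H]: there [nth] returns its default 0 and the tail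
   bound applies. *)
have [iH|Hi] := ltnP i (H * m.+1); last first.
  rewrite nth_default ?size_mkseq// rmorph0 subr0; apply: fH.
  apply: le_trans ix'; rewrite ler_pdivlMr// -natrM ler_nat//.
rewrite nth_mkseq//.
apply: (@le_trans _ _ e); last by rewrite ler_peMr ?weight_ge1// ltW.
rewrite -(subrK (f (i%:R / m.+1%:R)) (f x)) -addrA (splitr e).
apply: le_trans (ler_normD _ _) _; apply: lerD; last exact/ltW/af.
apply/ltW/fr => //.
- by rewrite ler_pdivrMr// -natrM ler_nat ltnW.
- by rewrite ger0_norm ?subr_ge0//; apply: lt_trans mr; rewrite ltrBlDl.
Qed.

End cspace_facts.

(** It suffices to treat an open [U]. Since [X] takes values in [C0], its preimage of [U] is the
    union of the preimages of the cells contained in [U]. There are countably many cells, each cut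
    out by countably many coordinate conditions. *)
Lemma measurable_preimage_Borel (d : measure_display) (T : measurableType d)
    (R : realType) (kappa : R) (X : T -> Cinf kappa) :
  (0 <= kappa)%R ->
  (forall t, (0 <= t)%R -> measurable_fun setT (fun w => X w t)) ->
  (forall w, C0 (X w)) ->
  forall B, Borel B -> measurable (X @^-1` B).
Proof.
move=> k0 mX XC0 B; apply: (@smallest_sub _ _ _ [set B | measurable (X @^-1` B)]).
  split => /=.
  - by rewrite preimage_set0.
  - by move=> A mA; rewrite setTD preimage_setC; exact: measurableC.
  - by move=> F mF; rewrite preimage_bigcup; exact: bigcupT_measurable.
move=> U oU /=.
have -> : X @^-1` U = \bigcup_(p in [set p | @cell R kappa p `<=` U]) (X @^-1` (cell p)).
  apply/seteqP; split=> [w /= Uw|w [p /= pU Xw]]; last exact: pU.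
  have /nbhs_ballP[e e0 eU] : nbhs (X w) U by exact: open_nbhs_nbhs.
  (* Cells with first index [k] have diameter at most [2 / (k + 1)], which is then less than [e]. *)
  pose k := Num.truncn (2 / e).
  have ke : (k.+1%:R^-1 *+ 2 < e)%R.
    rewrite -[ltLHS]mulr_natl ltr_pdivrMr// mulrC -ltr_pdivrMr//.
    have := @truncn_itv _ (2 / e)%R; rewrite divr_ge0 ?(ltW e0)// => /(_ isT)/andP[_].
    exact.
  have [m [s pw]] := C0_cell k (XC0 w).
  exists (k, m, s) => // g pg; apply: eU; rewrite /ball/= /rho_ball.
  by apply: le_lt_trans (cell_diameter k0 pw pg) _; rewrite lte_fin.
rewrite bigcup_mkcond; apply: countable_bigcupT_measurable.
  exact: countableP.
move=> p; case: ifPn => // _.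
have -> : X @^-1` (cell p) = \bigcap_(q in [set q : rat | (0 <= ratr q :> R)%R])
    ((fun w => X w (ratr q)) @^-1` [set x |
      `|x - ratr (nth 0 p.2 (Num.truncn (ratr q * p.1.2.+1%:R : R)))| <=
      p.1.1.+1%:R^-1 * weight kappa (ratr q)]%R).
  by apply/seteqP; split=> w /= h q; [exact: h|exact: h].
rewrite -[X in measurable X]setCK setC_bigcap; apply: measurableC.
rewrite bigcup_mkcond; apply: bigcupT_measurable_rat => q.
case: ifPn => //; rewrite inE/= => q0; apply: measurableC.
rewrite -[X in measurable X]setTI; apply: (mX _ q0) => //.
set a : R := ratr (nth _ _ _); set c := (_^-1 * weight _ _)%R.
have -> : [set x : R | (`|x - a| <= c)%R] = `[(a - c)%R, (a + c)%R]%classic.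
  by apply/seteqP; split=> x /=; rewrite in_itv/= ler_distl.
exact: measurable_itv.
Qed.

(** * The path spaces *)

Section cspace_metric.
Context (R : realType) (kappa : R).
Local Open Scope ring_scope.

(** The convention that paths vanish outside [D] turns equality on [D] into Leibniz equality. *)
Lemma cspace_ext (D : set R) (f g : cspace kappa D) :
  (forall t, D t -> f t = g t) -> f = g.
Proof.
move=> fg; have {}fg : f = g :> (R -> R).
  apply/funext => t; have [/fg//|Dt] := pselect (D t).
  by rewrite !cfun_out.
case: f g fg => f fc fo [g gc go] /= fg; subst g.
by congr CSpace; exact: Prop_irrelevance.
Qed.

Lemma continuous_within_dist (D : set R) (f : R -> R) :
  (forall t e, D t -> 0 < e ->
    exists2 r, 0 < r & forall s, D s -> `|s - t| < r -> `|f s - f t| < e) ->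
  {within D, continuous f}.
Proof.
move=> H t; apply/cvgrPdist_lt => e e0.
suff : forall t : R, @nbhs_subspace R D t [set s | `|f t - f s| < e] by exact.
move=> {}t.
(* Points outside [D] are isolated in the subspace topology, so continuity there is automatic. *)
have [Dt|Dt] := pselect (D t); last first.
  by rewrite -(nbhs_subspace_out Dt) => _ ->; rewrite /= subrr normr0.
rewrite -(nbhs_subspace_in Dt).
have [r r0 Hr] := H t e Dt e0; exists r => // s /=; rewrite distrC => st Ds.
by rewrite distrC; exact: Hr.
Qed.

Lemma open_rho_ball (D : set R) (f : cspace kappa D) (e : R) :
  open (rho_ball f e).
Proof.
rewrite openE => g fg; rewrite /interior; apply/nbhs_ballP.
have /exists_EFin_between[z /andP[fz]] := fg; rewrite lte_fin => ze.
exists (e - z); rewrite /= ?subr_gt0// => h gh.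
by rewrite -(subrK z e) addrC; exact: rho_ball_triangle gh.
Qed.

Lemma nbhs_rho_ball (D : set R) (f : cspace kappa D) (e : R) : 0 < e ->
  nbhs f (rho_ball f e).
Proof.
move=> e0; apply: open_nbhs_nbhs.
by split; [exact: open_rho_ball|exact: rho_ball_center].
Qed.

Lemma closure_rho_ball (D : set R) (f : cspace kappa D) (e : R) : 0 < e ->
  closure (rho_ball f (e / 2)) `<=` rho_ball f e.
Proof.
move=> e0 g /(_ (rho_ball g (e / 2))) [|h [fh gh]].
  by apply: nbhs_rho_ball; rewrite divr_gt0.
by rewrite (splitr e); apply: rho_ball_triangle fh (rho_ball_sym gh).
Qed.

Lemma restrE (T t : R) (f : Cinf kappa) : 0 <= t -> t <= T -> restr T f t = f t.
Proof. by move=> t0 tT /=; rewrite patchE mem_set//= in_itv/= t0. Qed.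

Lemma rho_restr (T : R) (f g : Cinf kappa) :
  (rho (restr T f) (restr T g) <= rho f g)%E.
Proof.
apply: ge_ereal_sup => _ [t tT <-]; move: (tT); rewrite /= in_itv/= => /andP[t0 tT'].
rewrite !patchE !mem_set//.
by apply: ereal_sup_ubound; exists t => //; rewrite itv0yE.
Qed.

Lemma rho_restr_le (S T : R) (f g : Cinf kappa) : S <= T ->
  (rho (restr S f) (restr S g) <= rho (restr T f) (restr T g))%E.
Proof.
move=> ST; apply: ge_ereal_sup => _ [t tT <-]; move: (tT).
rewrite /= in_itv/= => /andP[t0 tS].
apply: ereal_sup_ubound; exists t => /=; first by rewrite in_itv/= t0 (le_trans tS).
by rewrite !patchE !mem_set//= in_itv/= t0 (le_trans tS).
Qed.

(** Continuity of restriction, which is 1-Lipschitz for the two metrics. *)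
Lemma nbhs_restr (T : R) (f : Cinf kappa) (V : set (C0T kappa T)) :
  nbhs (restr T f) V -> nbhs f (restr T @^-1` V).
Proof.
move=> /nbhs_ballP[e e0 eV]; apply/nbhs_ballP; exists e => // g fg.
by apply: eV; apply: le_lt_trans fg; exact: rho_restr.
Qed.

Lemma Borel_open (S : topologicalType) (U : set S) : open U -> Borel U.
Proof. by move=> oU; exact: sub_sigma_algebra. Qed.

Lemma Borel_setC (S : topologicalType) (U : set S) : Borel U -> Borel (~` U).
Proof.
move=> BU; rewrite -setTD.
by have [_ + _] := @smallest_sigma_algebra S setT open; apply.
Qed.

Lemma Borel_restr (T : R) (B : set (C0T kappa T)) :
  Borel B -> Borel (restr T @^-1` B).
Proof.
have [B0 BC BU] := @smallest_sigma_algebra (Cinf kappa) setT open.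
apply: (@smallest_sub _ _ _ [set B | Borel (restr T @^-1` B)]).
  split => /=.
  - by rewrite preimage_set0.
  - by move=> A BA; rewrite setTD preimage_setC; exact: Borel_setC.
  - by move=> F BF; rewrite preimage_bigcup; exact: BU.
move=> U oU; apply: Borel_open; rewrite openE => f fU.
by apply: nbhs_restr; exact: open_nbhs_nbhs.
Qed.

(** * Tails of paths and gluing of restrictions *)

Lemma tail_sup_leP (T : R) (f : Cinf kappa) (c : R) :
  (tail_sup T f <= c%:E)%E <->
  forall t, 0 <= t -> T <= t -> `|f t| <= c * weight kappa t.
Proof.
split=> [H t t0 Tt|H].
  rewrite -ler_pdivrMr ?weight_gt0// -lee_fin; apply: le_trans H.
  by apply: ereal_sup_ubound; exists t.
apply: ge_ereal_sup => _ [t [t0 Tt] <-].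
by rewrite lee_fin ler_pdivrMr ?weight_gt0// H.
Qed.

Lemma le_tail_sup (S T : R) (f : Cinf kappa) : S <= T ->
  (tail_sup T f <= tail_sup S f)%E.
Proof.
move=> ST; apply: ge_ereal_sup => _ [t [t0 Tt] <-].
by apply: ereal_sup_ubound; exists t => //; split=> //; exact: le_trans Tt.
Qed.

Lemma tail_sup_triangle (T : R) (f g : Cinf kappa) (a b : R) :
  (rho f g <= a%:E)%E -> (tail_sup T g <= b%:E)%E -> (tail_sup T f <= (a + b)%:E)%E.
Proof.
move=> /rho_leP fg /tail_sup_leP gb; apply/tail_sup_leP => t t0 Tt.
rewrite mulrDl -(subrK (g t) (f t)).
apply: le_trans (ler_normD _ _) _; apply: lerD; last exact: gb.
by apply: fg; rewrite itv0yE.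
Qed.

(** A [rho]-perturbation of size less than [z - c] changes the tail supremum by at most [z - c].
    Openness makes the tail events of condition (III) Borel. *)
Lemma open_tail_sup (T c : R) : open [set f : Cinf kappa | (c%:E < tail_sup T f)%E].
Proof.
rewrite openE => f cf; rewrite /interior; apply/nbhs_ballP.
have /exists_EFin_between[z /andP[]] := cf; rewrite lte_fin => cz zf.
exists (z - c); rewrite /= ?subr_gt0// => g fg /=.
rewrite ltNge; apply: contraTN zf => gc; rewrite -leNgt.
rewrite -(subrK c z); apply: tail_sup_triangle gc.
exact: ltW.
Qed.

(** Up to [T] the restrictions decide; beyond [T] the difference is bounded by the sum of the two
    tails. This is how closeness on [[0, T]] becomes closeness in [rho]. *)
Lemma rho_le_split (T : R) (f g : Cinf kappa) (a b c : R) :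
  (rho (restr T f) (restr T g) <= c%:E)%E ->
  (tail_sup T f <= a%:E)%E -> (tail_sup T g <= b%:E)%E -> a + b <= c ->
  (rho f g <= c%:E)%E.
Proof.
move=> /rho_leP fg /tail_sup_leP fa /tail_sup_leP gb abc.
apply/rho_leP => t; rewrite itv0yE => t0; have [tT|/ltW Tt] := leP t T.
  by have := fg t; rewrite !restrE//; apply; rewrite /= in_itv/= t0.
apply: le_trans (ler_normB _ _) _.
apply: (@le_trans _ _ ((a + b) * weight kappa t)).
  by rewrite mulrDl; apply: lerD; [exact: fa|exact: gb].
by rewrite ler_pM2r ?weight_gt0.
Qed.

Lemma cspace_glue (p : forall n : nat, C0T kappa n.+1%:R) :
  (forall m n t, (m <= n)%N -> 0 <= t -> t <= m.+1%:R -> p m t = p n t) ->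
  exists f : Cinf kappa, forall n, restr n.+1%:R f = p n.
Proof.
move=> pp; pose phi t := if 0 <= t then p (Num.truncn t) t else 0.
have phiE n t : 0 <= t -> t <= n.+1%:R -> phi t = p n t.
  move=> t0 tn; rewrite /phi t0.
  have [tn'|nt] := leqP (Num.truncn t) n.
    by apply: pp => //; have /andP[_ /ltW] := truncn_itv t0.
  by apply/esym/pp => //; exact: ltnW.
have phic : {within `[0, +oo[, continuous phi}.
  apply: continuous_within_dist => t e; rewrite itv0yE => t0 e0.
  set n := Num.truncn t; have /andP[_ tn] := truncn_itv t0; rewrite -/n in tn.
  have tD : `[0, n.+2%:R]%classic t.
    by rewrite /= in_itv/= t0 (le_trans (ltW tn))// ler_nat.
  (* Since [t < n + 1], every [s] within distance 1 of [t] stays in [[0, n + 2]], the domain of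
     [p n.+1]; hence this index and the radius [Num.min r 1]. *)
  have [r r0 Hr] := @cspace_near _ _ _ (p n.+1) t e tD e0.
  exists (Num.min r 1); first by rewrite lt_min r0/=.
  move=> s; rewrite itv0yE => s0; rewrite lt_min => /andP[sr s1].
  have sn : s <= n.+2%:R.
    rewrite -natr1 -(subrK t s) addrC; apply: lerD; first exact: ltW.
    exact: le_trans (ler_norm _) (ltW s1).
  rewrite !(phiE n.+1)//; last by rewrite (le_trans (ltW tn))// ler_nat.
  by apply: Hr => //; rewrite /= in_itv/= s0.
have phio t : ~ `[0, +oo[%classic t -> phi t = 0.
  by rewrite itv0yE /phi => /negP/negbTE ->.
exists (@CSpace R kappa _ _ phic phio) => n; apply: cspace_ext => t /[dup] tD.
rewrite /= in_itv/= => /andP[t0 tn]; rewrite patchE mem_set//=; exact: phiE.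
Qed.

End cspace_metric.

Lemma limf_esup_le_near (R : realType) (f : R -> \bar R) (F : set_system R) (x : \bar R) :
  (\forall t \near F, f t <= x) -> limf_esup f F <= x.
Proof.
move=> fx; apply: (@le_trans _ _ (ereal_sup (f @` [set t | f t <= x]))).
  by apply: ereal_inf_lbound; eexists; first exact: fx.
by apply: ge_ereal_sup => _ [t ft <-].
Qed.

(** * The limit rate function *)

Section path_rate.
Context (R : realType) (kappa : R) (I0 : forall T : R, C0T kappa T -> \bar R).
Hypothesis I0_ge0 : forall T (f : C0T kappa T), (0 < T)%R -> 0 <= I0 f.
Hypothesis I0_mono : forall (S T : R) (f : Cinf kappa), (0 < S)%R -> (S <= T)%R ->
  I0 (restr S f) <= I0 (restr T f).

Lemma limit_rate_cvg (f : Cinf kappa) :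
  I0 (restr T f) @[T --> +oo%R] --> limit_rate I0 f.
Proof.
suff : cvg (I0 (restr T f) @[T --> +oo%R]) by [].
(* Monotonicity is known only for positive times; truncation at 1 makes the function monotone on all
   of [R] without changing it near [+oo]. *)
apply: (@cvgP _ _ (ereal_sup (range (fun T => I0 (restr (Num.max 1 T)%R f))))).
have /nondecreasing_cvge : {homo (fun T => I0 (restr (Num.max 1 T)%R f)) :
    S T / (S <= T)%R >-> S <= T}.
  move=> S T ST; apply: I0_mono; first by rewrite lt_max ltr01.
  by rewrite ge_max le_max lexx/= le_max ST orbT.
apply: cvg_trans; apply: near_eq_cvg; near=> T.
have T1 : (1 <= T)%R by near: T; exact: nbhs_pinfty_ge.
by rewrite (max_r T1).
Unshelve. all: by end_near.
Qed.

Lemma le_limit_rate (T : R) (f : Cinf kappa) : (0 < T)%R ->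
  I0 (restr T f) <= limit_rate I0 f.
Proof.
move=> T0; apply: cvge_to_ge (@limit_rate_cvg f) _.
by near=> U; apply: I0_mono => //; near: U; exact: nbhs_pinfty_ge.
Unshelve. all: by end_near.
Qed.

Lemma limit_rate_le_near (f : Cinf kappa) (x : \bar R) :
  (\forall T \near +oo%R, I0 (restr T f) <= x) -> limit_rate I0 f <= x.
Proof. exact: cvge_to_le (@limit_rate_cvg f). Qed.

Lemma limit_rate_ge0 (f : Cinf kappa) : 0 <= limit_rate I0 f.
Proof. by apply: le_trans (le_limit_rate f ltr01); exact: I0_ge0. Qed.

Lemma limit_rate_gt (f : Cinf kappa) (x : \bar R) :
  x < limit_rate I0 f -> exists2 T : R, (0 < T)%R & x < I0 (restr T f).
Proof.
move=> xf; apply: contrapT => H; move: xf; apply/negP; rewrite -leNgt.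
apply: limit_rate_le_near; near=> T; rewrite leNgt; apply/negP => xT.
by apply: H; exists T => //; near: T; exact: nbhs_pinfty_gt.
Unshelve. all: by end_near.
Qed.

Lemma B_plus_limit_rate (f : Cinf kappa) (r : R) :
  limit_rate I0 f <= r%:E -> B_plus I0 r f.
Proof.
move=> fr; apply: limf_esup_le_near; near=> T.
by apply: le_trans fr; apply: le_limit_rate; near: T; exact: nbhs_pinfty_gt.
Unshelve. all: by end_near.
Qed.

(** The limit dominates each [I0 (restr T f)] and exceeds [a] only if one of them does; that one is
    lower semicontinuous and restriction is continuous. *)
Lemma limit_rate_lsc :
  (forall T, (0 < T)%R -> lower_semicontinuous (@I0 T)) ->
  lower_semicontinuous (limit_rate I0).
Proof.
move=> lsc f a /limit_rate_gt[T T0 /(lsc T T0)[V fV aV]].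
exists (restr T @^-1` V); first exact: nbhs_restr.
by move=> g /aV/lt_le_trans; apply; exact: le_limit_rate.
Qed.

Hypothesis condII : forall r : R, (0 <= r)%R ->
  ereal_sup [set tail_sup T f | f in B_plus I0 r] @[T --> +oo%R] --> 0.

Lemma tail_sup_level (r e : R) : (0 <= r)%R -> (0 < e)%R ->
  \forall T \near +oo%R, forall f, limit_rate I0 f <= r%:E -> tail_sup T f <= e%:E.
Proof.
move=> r0 e0; have e0' : 0 < e%:E by rewrite lte_fin.
have : \forall T \near +oo%R, ereal_sup [set tail_sup T f | f in B_plus I0 r] < e%:E.
  exact: (@condII r r0 [set u | u < e%:E] (open_ereal_lt' e0')).
apply: filterS => T Te f /B_plus_limit_rate fr.
by apply: le_trans (ltW Te); apply: ereal_sup_ubound; exists f.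
Qed.

Lemma limit_rate_compact (r : R) : (0 <= r)%R ->
  (forall T, (0 < T)%R -> compact [set f : C0T kappa T | I0 f <= r%:E]) ->
  compact [set f | limit_rate I0 f <= r%:E].
Proof.
move=> r0 cI0; rewrite compact_ultra => F FU FK.
have lim n : exists p : C0T kappa n.+1%:R, I0 p <= r%:E /\
    forall V, nbhs p V -> F (restr n.+1%:R @^-1` V).
  have T0 : (0 < n.+1%:R :> R)%R by [].
  have FI : (restr n.+1%:R @ F) [set f : C0T kappa n.+1%:R | I0 f <= r%:E].
    have FI' : F (restr n.+1%:R @^-1` [set f | I0 f <= r%:E]); last exact: FI'.
    by apply: filterS FK => f fr; exact: le_trans (le_limit_rate f T0) fr.
  have [p [pr pc]] := cI0 _ T0 _ _ FI.
  exists p; split => // V pV.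
  (* A cluster point of an ultrafilter is a limit: otherwise the complement of [V] would belong to
     the image filter and would have to meet [V]. *)
  have [//|FV] := in_ultra_setVsetC (restr n.+1%:R @^-1` V) FU.
  have [q [/= qV]] := pc (~` V) V FV pV.
  by [].
pose p n := sval (cid (lim n)); have pP n := svalP (cid (lim n)); rewrite -/(p _) in pP.
have near_p n e : (0 < e)%R -> F [set g | rho (restr n.+1%:R g) (p n) <= e%:E].
  move=> e0; have [_ H] := pP n; have : nbhs (p n) (rho_ball (p n) e).
    exact: nbhs_rho_ball.
  by move=> /H; apply: filterS => g /rho_ball_sym/ltW.
(* The limits are consistent: some [g] in a set of the filter is close to both [p m] and [p n] at
   [t]. The tolerance is divided by [weight kappa t] to become a [rho] bound. *)
have [|f fp] := @cspace_glue R kappa p.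
  move=> m n t mn t0 tm; apply/eqP; rewrite -subr_eq0 -normr_le0.
  apply/ler_addgt0Pl => e e0; rewrite addr0.
  have w0 := weight_gt0 kappa t.
  have c0 : (0 < e / 2 / weight kappa t)%R by rewrite !divr_gt0.
  have tn : (t <= n.+1%:R)%R by rewrite (le_trans tm)// ler_nat.
  have [g [/rho_leP gm /rho_leP gn]] :=
    filter_ex (filterI (near_p m _ c0) (near_p n _ c0)).
  have := gm t; rewrite restrE// divfK ?gt_eqF// => /(_ _)gmt.
  have := gn t; rewrite restrE// divfK ?gt_eqF// => /(_ _)gnt.
  rewrite -(subrK (g t) (p m t)) -addrA (splitr e).
  apply: le_trans (ler_normD _ _) _; apply: lerD.
    by rewrite distrC; apply: gmt; rewrite /= in_itv/= t0.
  by apply: gnt; rewrite /= in_itv/= t0.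
have fr : limit_rate I0 f <= r%:E.
  apply: limit_rate_le_near; near=> T.
  have T0 : (0 < T)%R by near: T; exact: nbhs_pinfty_gt.
  apply: (@le_trans _ _ (I0 (restr (Num.truncn T).+1%:R f))).
    by apply: I0_mono => //; have /andP[_ /ltW] := truncn_itv (ltW T0).
  by rewrite fp; have [] := pP (Num.truncn T).
exists f; split => // V /nbhs_ballP[e /= e0 eV].
(* Two tails of size [e / 4] add up to [e / 2], the bound also used on [[0, n + 1]]; this leaves
   room for the strict inequality defining the ball. *)
have [M [_ MP]] := tail_sup_level r0 (divr_gt0 e0 (ltr0n R 4)).
pose n := Num.truncn (Num.max 0 M)%R.
have Mn : (M < n.+1%:R)%R.
  have := @truncn_itv _ (Num.max 0 M)%R; rewrite le_max lexx => /(_ isT)/andP[_].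
  by apply: le_lt_trans; rewrite le_max lexx orbT.
have e2 : (0 < e / 2)%R by rewrite divr_gt0.
apply: filterS (filterI FK (near_p n _ e2)) => g [gK gn]; apply: eV.
apply/rho_ball_sym; rewrite /rho_ball.
apply: (@le_lt_trans _ _ (e / 2)%:E); last first.
  by rewrite lte_fin ltr_pdivrMr// mulr_natr mulr2n ltrDl.
apply: (@rho_le_split _ _ n.+1%:R _ _ (e / 4) (e / 4)).
- by rewrite fp.
- exact: MP.
- exact: MP.
- by lra.
Unshelve. all: by end_near.
Qed.

End path_rate.

(** * Large deviation bounds *)

Section large_deviations.
Context (R : realType) (kappa : R) (d : nat -> measure_display)
  (Omega : forall n, measurableType (d n))
  (P : forall n, probability (Omega n) R)
  (X : forall n, Omega n -> Cinf kappa).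
Local Arguments X : clear implicits.
Hypothesis mX : forall n B, (1 <= n)%N -> Borel B -> measurable (X n @^-1` B).

Lemma probability_mono (A B : set (Cinf kappa)) : Borel A -> Borel B ->
  A `<=` B -> \forall n \near \oo, P n (X n @^-1` A) <= P n (X n @^-1` B).
Proof.
move=> mA mB AB; near=> n.
have n1 : (1 <= n)%N by near: n; exact: nbhs_infty_ge.
by apply: le_measure; rewrite ?inE; [exact: mX|exact: mX|exact: preimage_subset].
Unshelve. all: by end_near.
Qed.

Lemma probability_subadd (A B C : set (Cinf kappa)) : Borel A -> Borel B -> Borel C ->
  C `<=` A `|` B ->
  \forall n \near \oo, P n (X n @^-1` C) <= P n (X n @^-1` A) + P n (X n @^-1` B).
Proof.
move=> mA mB mC CAB; near=> n.
have n1 : (1 <= n)%N by near: n; exact: nbhs_infty_ge.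
apply: le_trans (measureU2 _ _ _); [|exact: mX|exact: mX].
apply: le_measure; rewrite ?inE; [exact: mX|exact: measurableU (mX n1 mA) (mX n1 mB)|].
by rewrite -preimage_setU; exact: preimage_subset.
Unshelve. all: by end_near.
Qed.

Lemma LDP_interior (S : topologicalType) (Y : forall n, Omega n -> S) (J : S -> \bar R)
    (B : set S) (x : S) : LDP P Y J -> Borel B -> nbhs x B ->
  - J x <= limn_einf (log_prob P (fun n => Y n @^-1` B)).
Proof.
move=> ldp mB xB; have [_] := ldp _ mB; apply: le_trans.
by rewrite leeN2; apply: ereal_inf_lbound; exists x.
Qed.

Lemma LDP_closure (S : topologicalType) (Y : forall n, Omega n -> S) (J : S -> \bar R)
    (B : set S) (c : \bar R) : LDP P Y J -> Borel B ->
  (forall x, closure B x -> c <= J x) ->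
  limn_esup (log_prob P (fun n => Y n @^-1` B)) <= - c.
Proof.
move=> ldp mB Bc; have [+ _] := ldp _ mB; move/le_trans; apply.
by rewrite leeN2; apply: le_ereal_inf_tmp => _ [x Bx <-]; exact: Bc.
Qed.

(** Being close to [f] on [[0, T]] implies being close on [[0, S]]. The lower bound at time [T] and
    the upper bound at time [S] on these two events give [- JT <= - y] for every real [y] below
    [JS (restr S f)]. *)
Lemma LDP_restr_mono (S T : R) (JS : C0T kappa S -> \bar R) (JT : C0T kappa T -> \bar R)
    (f : Cinf kappa) : (S <= T)%R -> lower_semicontinuous JS ->
  LDP P (fun n w => restr S (X n w)) JS -> LDP P (fun n w => restr T (X n w)) JT ->
  JS (restr S f) <= JT (restr T f).
Proof.
move=> ST lscS ldpS ldpT; apply: lee_EFin_lt => y yf.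
have [V /nbhs_ballP[e e0 eV] yV] := lscS _ _ yf.
(* Half the radius keeps the closure of the ball inside the region where [JS] exceeds [y]. *)
have e2 : (0 < e / 2)%R by rewrite divr_gt0.
pose BS := rho_ball (restr S f) (e / 2); pose BT := rho_ball (restr T f) (e / 2).
have mBS : Borel BS by apply: Borel_open; exact: open_rho_ball.
have mBT : Borel BT by apply: Borel_open; exact: open_rho_ball.
have nBT : nbhs (restr T f) BT.
  exact: nbhs_rho_ball.
have BTS : restr T @^-1` BT `<=` restr S @^-1` BS.
  by move=> g; apply: le_lt_trans; exact: rho_restr_le.
have BSy : forall g, closure BS g -> y%:E <= JS g.
  by move=> g /(closure_rho_ball e0) fg; apply/ltW/yV/eV.
rewrite -leeN2.
apply: (log_prob_einf_le_esup _ (LDP_interior ldpT mBT nBT) (LDP_closure ldpS mBS BSy)).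
exact: probability_mono (Borel_restr mBT) (Borel_restr mBS) BTS.
Qed.

(** The ball about [f] of radius [|f 0| / weight 0] contains no path starting at 0, so its
    probability vanishes for [n >= 1] and the lower bound forces an infinite rate. *)
Lemma LDP_support (T : R) (J : C0T kappa T -> \bar R) (f : C0T kappa T) :
  (0 < T)%R -> (forall n w, (1 <= n)%N -> X n w 0%R = 0%R) ->
  LDP P (fun n w => restr T (X n w)) J -> f 0%R != 0%R -> J f = +oo.
Proof.
move=> T0 X0 ldp f0.
have D0 : `[0%R, T]%classic (0%R : R) by rewrite /= in_itv/= lexx ltW.
pose e := (`|f 0| / weight kappa 0)%R.
have e0 : (0 < e)%R by rewrite divr_gt0 ?normr_gt0 ?weight_gt0.
have nf : nbhs f (rho_ball f e).
  exact: nbhs_rho_ball.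
have mf : Borel (rho_ball f e) by apply: Borel_open; exact: open_rho_ball.
suff : - J f <= -oo by rewrite leeNy_eq eqe_oppLR => /eqP.
apply: le_trans (LDP_interior ldp mf nf) _; apply: le_trans (limn_einf_sup _) _.
apply/log_prob_esupP => y _; near=> n.
have n1 : (1 <= n)%N by near: n; exact: nbhs_infty_ge.
rewrite (_ : _ @^-1` _ = set0) ?measure0 ?lee_fin ?expR_ge0//.
apply/seteqP; split=> // w; suff : ~ rho_ball f e (restr T (X n w)) by [].
have Xw0 : restr T (X n w) 0%R = 0%R by rewrite restrE ?X0// ltW.
rewrite /rho_ball; apply/negP; rewrite -leNgt.
by apply: ereal_sup_ubound; exists 0%R => //; rewrite Xw0 subr0.
Unshelve. all: by end_near.
Qed.

(** * Passage from the segments [[0, T]] to the half-line *)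

Context (I0 : forall T : R, C0T kappa T -> \bar R).
Hypothesis I0_good : forall T : R, (0 < T)%R -> good_rate_function (@I0 T).
Hypothesis I0_ldp : forall T : R, (0 < T)%R -> LDP P (fun n w => restr T (X n w)) (@I0 T).

Lemma path_rate_mono (S T : R) (f : Cinf kappa) : (0 < S)%R -> (S <= T)%R ->
  I0 (restr S f) <= I0 (restr T f).
Proof.
move=> S0 ST; have T0 := lt_le_trans S0 ST; have [_ lsc _] := I0_good S0.
exact: LDP_restr_mono ST lsc (I0_ldp S0) (I0_ldp T0).
Qed.

Lemma path_rate_ge0 (T : R) (f : C0T kappa T) : (0 < T)%R -> 0 <= I0 f.
Proof. by move=> /I0_good[]. Qed.

Hypothesis condII : forall r : R, (0 <= r)%R ->
  ereal_sup [set tail_sup T f | f in B_plus I0 r] @[T --> +oo%R] --> 0.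
Hypothesis condIII : forall N e : R, (0 < e)%R -> exists T : R,
  limn_esup (log_prob P (fun n => [set w | e%:E < tail_sup T (X n w)])) <= - N%:E.

(** Combines (II) and (III) at one common [T]: tails decrease in [T], so the time given by (III) may
    be enlarged until (II) takes effect. *)
Lemma exponential_tail (r N e : R) : (0 <= r)%R -> (0 < e)%R ->
  exists T : R, [/\ (0 < T)%R,
    forall f, limit_rate I0 f <= r%:E -> tail_sup T f <= e%:E &
    limn_esup (log_prob P (fun n => X n @^-1` [set f | e%:E < tail_sup T f])) <=
      - N%:E].
Proof.
move=> r0 e0; have [T1 T1N] := condIII N e0.
have H := tail_sup_level path_rate_mono condII r0 e0.
near (pinfty_nbhs R) => T; exists T; split.
- by near: T; exact: nbhs_pinfty_gt.
- by near: T.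
have T1T : (T1 <= T)%R by [].
apply: log_prob_esup_mono T1N.
apply: (@probability_mono [set f | e%:E < tail_sup T f] [set f | e%:E < tail_sup T1 f]).
- by apply: Borel_open; exact: open_tail_sup.
- by apply: Borel_open; exact: open_tail_sup.
by move=> f /lt_le_trans; apply; exact: le_tail_sup.
Unshelve. all: by end_near.
Qed.

Lemma limit_rate_good : good_rate_function (limit_rate I0).
Proof.
split.
- exact: limit_rate_ge0 path_rate_ge0 path_rate_mono.
- by apply: (limit_rate_lsc path_rate_mono) => T /I0_good[].
- move=> r r0; apply: (limit_rate_compact path_rate_mono condII r0) => T T0.
  by have [_ _] := I0_good T0; apply.
Qed.

Lemma limit_rate_lower (B : set (Cinf kappa)) : Borel B ->
  - rate_of_set (limit_rate I0) (interior B) <=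
  limn_einf (log_prob P (fun n => X n @^-1` B)).
Proof.
move=> mB; rewrite leeNl; apply: le_ereal_inf_tmp => _ [f fB <-].
rewrite leeNl.
have := limit_rate_ge0 path_rate_ge0 path_rate_mono f.
case fc : (limit_rate I0 f) => [c| |] // c0; last by rewrite leNye.
have /nbhs_ballP[e /= e0 eB] := fB.
have e2 : (0 < e / 2)%R by rewrite divr_gt0.
have e4 : (0 < e / 4)%R by rewrite divr_gt0.
(* The rate [c + 1] is strictly above [c = I(f)], so the tail event cannot cancel the probability of
   [A]. *)
have [T [T0 fT XT]] := exponential_tail (c + 1) c0 e4.
pose A := rho_ball (restr T f) (e / 2).
have mA : Borel A by apply: Borel_open; exact: open_rho_ball.
have nA : nbhs (restr T f) A.
  exact: nbhs_rho_ball.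
apply: (log_prob_einfD _ _ _ XT).
- by rewrite -EFinN lte_fin ltrN2 ltrDl.
- apply: (@probability_subadd B [set f | (e / 4)%:E < tail_sup T f]
    (restr T @^-1` A)) => //.
  + by apply: Borel_open; exact: open_tail_sup.
  + exact: Borel_restr.
  move=> g Ag; have [gT|] := leP (tail_sup T g) (e / 4)%:E; last by right.
  left; apply: eB; apply: (@le_lt_trans _ _ (e / 2)%:E).
    apply: (rho_le_split (ltW Ag) (fT f _) gT); rewrite ?fc//; lra.
  by rewrite lte_fin; lra.
apply: le_trans (LDP_interior (I0_ldp T0) mA nA).
by rewrite EFinN leeN2 -fc; exact: (le_limit_rate path_rate_mono).
Qed.

Hypothesis X_at0 : forall n w, (1 <= n)%N -> X n w 0%R = 0%R.
Hypothesis I0_ext : forall (T : R) (f : C0T kappa T), (0 < T)%R -> f 0%R = 0%R ->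
  exists g : Cinf kappa, restr T g = f /\
    forall U : R, (T <= U)%R -> I0 (restr U g) = I0 f.

(** A finite rate forces [h 0 = 0], so the extension of condition (I) exists; its rate is constant
    from [T] on and passes to the limit. *)
Lemma limit_rate_ext (T : R) (h : C0T kappa T) (c : R) : (0 < T)%R -> I0 h <= c%:E ->
  exists2 g : Cinf kappa, restr T g = h & limit_rate I0 g <= c%:E.
Proof.
move=> T0 hc; have h0 : h 0%R = 0%R.
  apply/eqP; apply: contraTT hc => h0.
  by rewrite (LDP_support T0 X_at0 (I0_ldp T0) h0).
have [g [gh gU]] := I0_ext T0 h0; exists g => //.
apply: (limit_rate_le_near path_rate_mono); near=> U.
by rewrite gU//; near: U; exact: nbhs_pinfty_ge.
Unshelve. all: by end_near.
Qed.

(** A local radius [e] at [f] yields the radius [e / 2] uniformly on the ball of radius [e / 2]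
    about [f]; near-covering compactness then gives one radius for all of [K]. *)
Lemma compact_rho_separated (K F : set (Cinf kappa)) : compact K ->
  closed F -> K `&` F = set0 ->
  exists2 e : R, (0 < e)%R & forall f g, K f -> F g -> ~ rho_ball f e g.
Proof.
move=> /compact_near_coveringP cK cF KF.
pose Q (e : R) f := forall g, F g -> ~ rho_ball f e g.
have : \forall e \near (0:R)^'+, K `<=` Q e.
  apply: cK => f Kf.
  have /nbhs_ballP[e /= e0 eF] : nbhs f (~` F).
    apply: open_nbhs_nbhs; split; first exact: closed_openC.
    by move=> Ff; have : (K `&` F) f by []; rewrite KF.
  have e2 : (0 < e / 2)%R by rewrite divr_gt0.
  exists (ball f (e / 2), [set x | (x < e / 2)%R]) => /=.
    by split; [exact: nbhsx_ballx|exact: nbhs_right_lt].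
  move=> -[f' x]/= [ff' xe] g Fg f'g; apply: (eF g) => //.
  rewrite (splitr e); apply: rho_ball_triangle ff' _.
  by apply: lt_trans f'g _; rewrite lte_fin.
move=> KQ; near (0:R)^'+ => e; exists e; first by near: e; exact: nbhs_right_gt.
by move=> f g Kf; apply: (near KQ e).
Unshelve. all: by end_near.
Qed.

Lemma limit_rate_upper (B : set (Cinf kappa)) : Borel B ->
  limn_esup (log_prob P (fun n => X n @^-1` B)) <=
  - rate_of_set (limit_rate I0) (closure B).
Proof.
move=> mB; apply: lee_EFin_gt => y; rewrite lteNl -EFinN => yB.
(* A nonnegative [y] is a trivial bound, as probabilities are at most 1; otherwise [c = - y] is a
   legitimate level. *)
have [y0|y0] := leP 0%R y.
  apply: (@le_trans _ _ 0); last by rewrite lee_fin.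
  apply: log_prob_esup_le0; near=> n; apply: mX => //.
  by near: n; exact: nbhs_infty_ge.
pose c := (- y)%R; have c0 : (0 <= c)%R by rewrite oppr_ge0 ltW.
have -> : y%:E = - c%:E by rewrite -EFinN opprK.
have [_ _ /(_ c c0) cK] := limit_rate_good.
have [|e e0 eKB] := compact_rho_separated cK (@closed_closure _ B).
  apply/seteqP; split => // f [/= fc fB]; move: yB; apply/negP; rewrite -leNgt.
  by apply: le_trans fc; apply: ereal_inf_lbound; exists f.
have e4 : (0 < e / 4)%R by rewrite divr_gt0.
have [T [T0 fT XT]] := exponential_tail c c0 e4.
(* [G] is closed and misses the level set, so the upper bound on [[0, T]] gives it rate at least
   [c]. *)
pose G : set (C0T kappa T) :=
  ~` \bigcup_(k in [set k | I0 k <= c%:E]) rho_ball k (e / 2).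
have oG : open (~` G) by rewrite setCK; apply: bigcup_open => k _; exact: open_rho_ball.
have cG : closed G by rewrite -openC.
have mG : Borel G by rewrite -[G]setCK; apply: Borel_setC; exact: Borel_open.
apply: (log_prob_esupU _ _ XT); last first.
  apply: (LDP_closure (I0_ldp T0) mG) => h; rewrite -(closure_id _).1// => Gh.
  rewrite leNgt; apply/negP => /ltW hc; apply: Gh; exists h => //.
  by apply: rho_ball_center; rewrite divr_gt0.
apply: (@probability_subadd (restr T @^-1` G)
  [set f | (e / 4)%:E < tail_sup T f]) => //.
- exact: Borel_restr.
- by apply: Borel_open; exact: open_tail_sup.
move=> f Bf; have [fTe|] := leP (tail_sup T f) (e / 4)%:E; last by right.
(* If [f] were within [e / 2] of some [k] in the level set on [[0, T]], the extension [g] of [k]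
   would lie in [{I <= c}] with tail at most [e / 4], hence within [e / 2] of [f], against the
   separation [e]. *)
left => -[k /= kc kf]; have [g gk gc] := limit_rate_ext T0 kc.
apply: (eKB g f gc); first exact: subset_closure.
rewrite /rho_ball; apply: (@le_lt_trans _ _ (e / 2)%:E).
  apply: (rho_le_split _ (fT g gc) fTe); first by rewrite gk ltW.
  lra.
by rewrite lte_fin; lra.
Unshelve. all: by end_near.
Qed.

End large_deviations.

Theorem theorem2p1 (R : realType) (kappa : R) (d : nat -> measure_display)
  (Omega : forall n, measurableType (d n))
  (P : forall n, probability (Omega n) R)
  (X : forall n, Omega n -> Cinf kappa)
  (I0 : forall T : R, C0T kappa T -> \bar R)
  (kappa_ge0 : (0 <= kappa)%R)
  (X_process : forall n t, (1 <= n)%N -> (0 <= t)%R ->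
     measurable_fun setT (fun w => X n w t))
  (X_C0 : forall n w, (1 <= n)%N -> C0 (X n w))
  (condI_ldp : forall T : R, (0 < T)%R ->
     good_rate_function (I0 T) /\ LDP P (fun n w => restr T (X n w)) (I0 T))
  (condI_ext : forall (T : R) (f : C0T kappa T), (0 < T)%R -> f 0%R = 0%R ->
     exists g : Cinf kappa, [/\ C0 g, restr T g = f &
       forall U : R, (T <= U)%R -> I0 U (restr U g) = I0 T f])
  (condII : forall r : R, (0 <= r)%R ->
     ereal_sup [set tail_sup T f | f in B_plus I0 r] @[T --> +oo%R] --> 0)
  (condIII : forall N e : R, (0 < e)%R -> exists T : R,
     limn_esup (log_prob P (fun n => [set w | e%:E < tail_sup T (X n w)]))
       <= - N%:E) :
  (forall f : Cinf kappa,
     cvg (I0 T (restr T f) @[T --> +oo%R]) /\ 0 <= limit_rate I0 f) /\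
  good_rate_function (limit_rate I0) /\
  LDP P X (limit_rate I0).
Proof.
have mX n B : (1 <= n)%N -> Borel B -> measurable (X n @^-1` B).
  move=> n1; apply: measurable_preimage_Borel => //.
  - by move=> t; exact: X_process.
  - by move=> w; exact: X_C0.
have good T (T0 : (0 < T)%R) := (condI_ldp T T0).1.
have ldp T (T0 : (0 < T)%R) := (condI_ldp T T0).2.
have mono := path_rate_mono mX good ldp.
have X0 n w : (1 <= n)%N -> X n w 0%R = 0%R by move=> /(X_C0 n w)[].
have ext T (f : C0T kappa T) : (0 < T)%R -> f 0%R = 0%R ->
    exists g : Cinf kappa, restr T g = f /\
      forall U : R, (T <= U)%R -> I0 U (restr U g) = I0 T f.
  by move=> T0 /(condI_ext T f T0)[g [_ gf gU]]; exists g.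
split; [|split].
- move=> f; split; first exact: (limit_rate_cvg mono).
  exact: (limit_rate_ge0 (path_rate_ge0 good) mono).
- exact: (limit_rate_good mX good ldp condII).
- move=> B mB; split; last exact: (limit_rate_lower mX good ldp condII condIII).
  exact: (limit_rate_upper mX good ldp condII condIII X0 ext).
Qed.
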